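(* Let $\Theta$ be a parameter space, $\mathcal{A}$ an action space, $\mathcal{P}=\{P_\theta:\theta\in\Theta\}$ a family of probability measures on a sample space $\mathcal{X}$, and $w$ a probability measure (prior) on $\Theta$. Suppose that the loss function $L:\Theta\times\mathcal{A}\to\{0,1\}$ is zero-one valued, and let $R_0:=\inf_{a\in\mathcal{A}}\int_\Theta L(\theta,a)\,w(\mathrm{d}\theta)$, with $R_0>0$. Then for every convex function $f:(0,\infty)\to\mathbb{R}$ with $f(1)=0$, $$I_f(w,\mathcal{P})\;\ge\;\phi_f\big(R_{\rm Bayes}(w),R_0\big),$$ where $R_{\rm Bayes}(w)$ is the Bayes risk, $I_f(w,\mathcal{P})$ is the $f$-informativity and $\phi_f$ is the binary $f$-divergence function.
   Context: All functions and sets are assumed measurable as needed. The Bayes risk is $R_{\rm Bayes}(w)=R_{\rm Bayes}(w,L;\Theta):=\inf_{\mathfrak{d}}\int_\Theta \mathbb{E}_\theta L(\theta,\mathfrak{d}(X))\,w(\mathrm{d}\theta)$, the infimum being over all decision rules $\mathfrak{d}:\mathcal{X}\to\mathcal{A}$, where $\mathbb{E}_\theta$ is expectation under $X\sim P_\theta$. (The existence of a Bayes rule attaining the infimum is not assumed.) For convex $f:(0,\infty)\to\mathbb{R}$ with $f(1)=0$, put $f(0):=\lim_{x\downarrow0}f(x)$ and $f'(\infty):=\lim_{x\uparrow\infty}f(x)/x$ (possibly $+\infty$). For probability measures $P,Q$ with densities $p,q$ with respect to a common measure $\mu$, the $f$-divergence is $D_f(P\|Q):=\int f(p/q)\,q\,\mathrm{d}\mu+f'(\infty)P\{q=0\}$,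 with the convention $0\cdot\infty=0$. The $f$-informativity is $I_f(w,\mathcal{P}):=\inf_Q\int_\Theta D_f(P_\theta\|Q)\,w(\mathrm{d}\theta)$, the infimum being over all probability measures $Q$ on $\mathcal{X}$. For $a,b\in[0,1]$, $\phi_f(a,b)$ is the $f$-divergence $D_f(P\|Q)$ between the probability measures on $\{0,1\}$ with $P\{1\}=a$, $Q\{1\}=b$; explicitly, $\phi_f(a,b)=bf(a/b)+(1-b)f\big(\tfrac{1-a}{1-b}\big)$ if $0<b<1$; $\phi_f(a,0)=f(1-a)+af'(\infty)$; $\phi_f(a,1)=f(a)+(1-a)f'(\infty)$ (values may be $+\infty$). *)

(* Defs.v *)
From HB Require Import structures.
From mathcomp Require Import all_boot all_order all_algebra.
From mathcomp Require Import all_classical all_reals all_analysis.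
From mathcomp Require Import measurable_realfun.
From mathcomp Require Import ring.

Set Implicit Arguments.
Unset Strict Implicit.
Unset Printing Implicit Defensive.
Import Order.TTheory GRing.Theory Num.Theory.
Import numFieldNormedType.Exports.
Local Open Scope classical_set_scope.
Local Open Scope ring_scope.
Local Open Scope ereal_scope.

Section measure_sum.
Context d (X : measurableType d) (R : realType) (P Q : probability X R).

Definition msum2 : set X -> \bar R := measure_add P Q.

HB.instance Definition _ := Measure.on msum2.

Let msum2_fin : fin_num_fun msum2.
Proof. by move=> B mB; rewrite /msum2 measure_addE fin_numD !fin_num_measure. Qed.

HB.instance Definition _ := @Measure_isFinite.Build _ _ _ msum2 msum2_fin.

End measure_sum.

Section f_divergence.
Context (R : realType) (f : R -> R).

(* Only the values of [f] on the open half-line matter, and at [0] the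
   extension takes the one-sided limit, possibly [+oo]. *)
Definition fext (x : R) : \bar R :=
  if (0 < x)%R then (f x)%:E else lim ((f y)%:E @[y --> 0%R^'+]).

Definition fslope_oo : \bar R := lim ((f y / y)%:E @[y --> +oo%R]).

Definition is_density d (X : measurableType d) (mu P : set X -> \bar R)
    (p : X -> R) : Prop :=
  [/\ measurable_fun setT p, (forall x, 0 <= p x)%R &
      forall B, measurable B -> P B = \int[mu]_(x in B) (p x)%:E].

(* The integral is restricted to [0 < q], which is the convention
   [0 * oo = 0] at the points where [q] vanishes. *)
Definition fdiv_density d (X : measurableType d) (mu P : set X -> \bar R)
    (p q : X -> R) : \bar R :=
  \int[mu]_(x in [set x | (0 < q x)%R]) (fext (p x / q x) * (q x)%:E)
  + fslope_oo * P [set x | q x = 0%R].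

Definition density_msum2 d (X : measurableType d) (P Q S : probability X R)
    (x : X) : R :=
  fine (Radon_Nikodym_SigmaFinite.f S (msum2 P Q) x).

(* The dominating measure is [P + Q]; by [fdiv_density_indep] below, any other
   sigma-finite measure and densities give the same value when [f] is convex. *)
Definition fdiv d (X : measurableType d) (P Q : probability X R) : \bar R :=
  fdiv_density (msum2 P Q) P (density_msum2 P Q P) (density_msum2 P Q Q).

(* [fdiv_bernoulli] below identifies this formula with the divergence between
   the Bernoulli measures of parameters [a] and [b]. *)
Definition phi_f (a b : R) : \bar R :=
  if b == 0%R then fext (1 - a) + a%:E * fslope_oo
  else if b == 1%R then fext a + (1 - a)%:E * fslope_oo
  else b%:E * fext (a / b) + (1 - b)%:E * fext ((1 - a) / (1 - b)).

Definition f_informativity d d' (Theta : measurableType d)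
    (X : measurableType d') (w : probability Theta R)
    (P : Theta -> probability X R) : \bar R :=
  ereal_inf [set \int[w]_t fdiv (P t) Q | Q in [set: probability X R]].

End f_divergence.

Section risk.
Context (R : realType) (d d' d'' : measure_display).
Context (Theta : measurableType d) (A : measurableType d')
  (X : measurableType d'').
Implicit Types (w : probability Theta R) (L : Theta -> A -> R)
  (P : Theta -> probability X R).

Definition bayes_risk w L P : \bar R :=
  ereal_inf [set \int[w]_t \int[P t]_x (L t (delta x))%:E
            | delta in [set delta : X -> A | measurable_fun setT delta]].

Definition no_data_risk w L : \bar R :=
  ereal_inf [set \int[w]_t (L t a)%:E | a in [set: A]].

End risk.

Section density_lemmas.
Context (R : realType) d (X : measurableType d).

Lemma density_null_dominates (mu nu : {measure set X -> \bar R}) (r : X -> R) :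
  is_density mu nu r -> nu `<< mu.
Proof.
move=> [mr r0 nuE] B /= B0 C mC CB.
rewrite nuE//; apply: null_set_integral => //.
  exact/measurable_EFinP/(measurable_funS measurableT).
exact: B0.
Qed.

Lemma density_ae_eq (mu : {sigma_finite_measure set X -> \bar R})
    (nu : {finite_measure set X -> \bar R}) (r s : X -> R) :
  is_density mu nu r -> is_density mu nu s ->
  ae_eq mu setT (EFin \o r) (EFin \o s).
Proof.
move=> [mr r0 rE] [ms s0 sE].
apply: integral_ae_eq => //.
- apply/integrableP; split; first exact/measurable_EFinP.
  under eq_integral do rewrite gee0_abs ?lee_fin//.
  by rewrite -rE// ltey_eq fin_num_measure.
- exact/measurable_EFinP.
- by move=> B _ mB; rewrite -rE// -sE.
Qed.

Lemma density_RN (mu : {sigma_finite_measure set X -> \bar R})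
    (nu : {finite_measure set X -> \bar R}) : nu `<< mu ->
  is_density mu nu (fine \o Radon_Nikodym_SigmaFinite.f nu mu).
Proof.
move=> numu; split.
- apply/measurable_EFinP/(eq_measurable_fun (Radon_Nikodym_SigmaFinite.f nu mu)).
    by move=> x _ /=; rewrite fineK ?Radon_Nikodym_SigmaFinite.f_fin_num.
  exact: measurable_int (Radon_Nikodym_SigmaFinite.f_integrable _).
- by move=> x /=; rewrite fine_ge0 ?Radon_Nikodym_SigmaFinite.f_ge0.
- move=> B mB; rewrite (Radon_Nikodym_SigmaFinite.f_integral numu mB).
  by apply: eq_integral => x _ /=; rewrite fineK ?Radon_Nikodym_SigmaFinite.f_fin_num.
Qed.

Lemma ge0_integral_density (mu : {sigma_finite_measure set X -> \bar R})
    (nu : {finite_measure set X -> \bar R}) (r : X -> R) D (g : X -> \bar R) :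
  is_density mu nu r -> measurable D -> measurable_fun D g ->
  (forall x, 0 <= g x) ->
  \int[nu]_(x in D) g x = \int[mu]_(x in D) (g x * (r x)%:E).
Proof.
move=> dr mD mg g0; have numu := density_null_dominates dr.
rewrite -(Radon_Nikodym_SigmaFinite.change_of_variables numu g0 mD mg).
have [mr _ _] := dr; have [ms _ _] := density_RN numu.
have aeE := density_ae_eq (density_RN numu) dr.
apply: ae_eq_integral => //.
- apply: emeasurable_funM => //; apply: measurable_funTS.
  exact: measurable_int (Radon_Nikodym_SigmaFinite.f_integrable _).
- by apply: emeasurable_funM => //; apply/measurable_EFinP/measurable_funTS.
- apply: filterS aeE => x /= /(_ I) <- _.
  by rewrite fineK ?Radon_Nikodym_SigmaFinite.f_fin_num.
Qed.

Lemma integral_density (mu : {sigma_finite_measure set X -> \bar R})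
    (nu : {finite_measure set X -> \bar R}) (r : X -> R) D (g : X -> \bar R) :
  is_density mu nu r -> measurable D -> measurable_fun D g ->
  \int[nu]_(x in D) g x = \int[mu]_(x in D) (g x * (r x)%:E).
Proof.
move=> dr mD mg; rewrite integralE [RHS]integralE; have [_ r0 _] := dr.
have E1 x : (fun x => g x * (r x)%:E)^\+ x = g^\+ x * (r x)%:E.
  by rewrite !funeposE maxe_pMl ?mul0e ?lee_fin.
have E2 x : (fun x => g x * (r x)%:E)^\- x = g^\- x * (r x)%:E.
  by rewrite !funenegE maxe_pMl ?mul0e ?lee_fin// mulNe.
by under [X in _ = X - _]eq_integral do rewrite E1;
   under [X in _ = _ - X]eq_integral do rewrite E2;
   rewrite -!(ge0_integral_density dr)//;
   [exact: measurable_funeneg|exact: measurable_funepos].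
Qed.

Lemma measurable_fext (f : R -> R) :
  convex_function (E := R^o) `]0%R, +oo[%classic f ->
  measurable_fun setT (fext f).
Proof.
move=> cf; apply: measurable_fun_if => //.
  exact: measurable_fun_ltr.
rewrite setTI; apply/measurable_EFinP.
apply: (measurability _ (RGenInftyO.measurableE R)).
move=> _ [_ [r ->] <-].
apply: is_interval_measurable => x y /= [x0 fx] [y0 fy] z /andP[xz zy].
split; first exact: lt_le_trans x0 xz.
move: fx fy; rewrite !in_itv/= => fx fy.
have [xy|yx] := ltP x y; last first.
  by have -> : z = x by apply/eqP; rewrite eq_le xz (le_trans zy yx).
have xy0 : (0 < y - x)%R by rewrite subr_gt0.
have t0 : (0 <= (y - z) / (y - x))%R by rewrite divr_ge0 ?subr_ge0// ltW.
have t1 : ((y - z) / (y - x) <= 1)%R by rewrite ler_pdivrMr// mul1r lerB.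
pose t := ((y - z) / (y - x))%R.
have fz : (f z <= t * f x + (1 - t) * f y)%R.
  have := cf (Itv01 t0 t1) x y.
  rewrite !inE/= !in_itv/= !andbT => /(_ x0 (lt_trans x0 xy)).
  congr (f _ <= _)%R; change (t * x + (1 - t) * y = z)%R.
  by rewrite /t; field; rewrite gt_eqF.
apply: (le_lt_trans fz); apply: (@le_lt_trans _ _ (Num.max (f x) (f y))); last first.
  by rewrite gt_max fx.
have m1 : (f x <= Num.max (f x) (f y))%R by rewrite le_max lexx.
have m2 : (f y <= Num.max (f x) (f y))%R by rewrite le_max lexx orbT.
have -> : Num.max (f x) (f y) =
    (t * Num.max (f x) (f y) + (1 - t) * Num.max (f x) (f y))%R.
  by rewrite -mulrDl subrKC mul1r.
by rewrite lerD// ler_wpM2l// subr_ge0.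
Qed.

Let measurable_invr : measurable_fun setT (fun x : R => x^-1)%R.
Proof.
have -> : (fun x : R => x^-1)%R = (fun x => x * (x ^+ 2) `^ (-1))%R.
  apply/funext => x; rewrite powR_inv1 ?sqr_ge0//.
  by have [->|x0] := eqVneq x 0%R; [rewrite invr0 mul0r|field].
apply: measurable_funM => //; apply: (measurableT_comp (measurable_powR (-1))).
exact: measurable_funX.
Qed.

Lemma fdiv_density_indep (f : R -> R) (P Q : probability X R)
    (mu : {sigma_finite_measure set X -> \bar R}) (p q : X -> R) :
  convex_function (E := R^o) `]0%R, +oo[%classic f ->
  is_density mu P p -> is_density mu Q q ->
  fdiv f P Q = fdiv_density f mu P p q.
Proof.
move=> cf dp dq.
have mf := measurable_fext cf.
have [mp p0 pE] := dp; have [mq q0 qE] := dq.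
have Pnu : P `<< msum2 P Q.
  move=> B B0 C mC CB; have := B0 _ mC CB; rewrite /msum2/= measure_addE => /eqP.
  by rewrite padde_eq0// => /andP[/eqP].
have Qnu : Q `<< msum2 P Q.
  move=> B B0 C mC CB; have := B0 _ mC CB; rewrite /msum2/= measure_addE => /eqP.
  by rewrite padde_eq0// => /andP[_ /eqP].
have dp' := density_RN Pnu; have dq' := density_RN Qnu.
rewrite /fdiv; set p' := density_msum2 P Q P; set q' := density_msum2 P Q Q.
rewrite -/(density_msum2 P Q P) -/p' in dp'.
rewrite -/(density_msum2 P Q Q) -/q' in dq'.
have [mp' p'0 p'E] := dp'; have [mq' q'0 q'E] := dq'.
pose r := (p \+ q)%R.
have r0 x : (0 <= r x)%R by rewrite addr_ge0.
have mr : measurable_fun setT r by exact: measurable_funD.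
have dr : is_density mu (msum2 P Q) r.
  split => // B mB; transitivity (P B + Q B); first exact: measure_addE.
  rewrite pE// qE//.
  rewrite -ge0_integralD//=; [by move=> x _; rewrite lee_fin| |
    by move=> x _; rewrite lee_fin|];
    by apply/measurable_EFinP; exact: measurable_funTS.
have key (S : probability X R) (s' s : X -> R) : is_density (msum2 P Q) S s' ->
    is_density mu S s -> ae_eq mu setT (EFin \o s) (EFin \o (s' \* r)%R).
  move=> ds' ds; apply: (density_ae_eq ds); have [ms' s'0 s'E] := ds'.
  split; [exact: measurable_funM|by move=> x; rewrite mulr_ge0|move=> B mB].
  apply: (etrans (s'E B mB)); apply: (integral_density dr) => //.
  by apply/measurable_EFinP/measurable_funTS.
have ap := key _ _ _ dp' dp; have aq := key _ _ _ dq' dq.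
have mpos (s : X -> R) : measurable_fun setT s ->
    measurable [set x | (0 < s x)%R].
  move=> ms; rewrite -[X in measurable X]setTI.
  have mb : measurable_fun setT (fun x => (0 < s x)%R).
    exact: measurable_fun_ltr.
  exact: (mb measurableT [set true]).
have mzero (s : X -> R) : measurable_fun setT s ->
    measurable [set x | s x = 0%R].
  move=> ms; rewrite -[X in measurable X]setTI.
  exact: (ms measurableT [set 0%R]).
have mG (s t : X -> R) : measurable_fun setT s -> measurable_fun setT t ->
    measurable_fun setT (fun x => fext f (s x / t x) * (t x)%:E).
  move=> ms mt; apply: emeasurable_funM; last exact/measurable_EFinP.
  apply: (measurableT_comp mf); apply: measurable_funM => //.
  exact: (measurableT_comp measurable_invr).
have memb (b : X -> bool) x : (x \in [set y | b y]) = b x.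
  by apply/idP/idP; rewrite inE.
have mem0 (s : X -> R) x : (x \in [set y | s y = 0%R]) = (s x == 0%R).
  by apply/idP/eqP; rewrite inE.
have rq x : q x = (q' x * r x)%R -> r x != 0%R ->
    ((0 < q x)%R = (0 < q' x)%R) * ((q x == 0%R) = (q' x == 0%R)).
  move=> -> rx; have rx0 : (0 < r x)%R by rewrite lt_neqAle eq_sym rx r0.
  by rewrite pmulr_lgt0// mulf_eq0 (negbTE rx) orbF.
have rp x : r x = 0%R -> p x = 0%R /\ q x = 0%R.
  by move=> /eqP; rewrite paddr_eq0// => /andP[/eqP ? /eqP ?].
rewrite /fdiv_density; congr (_ + _ * _).
- rewrite (integral_density dr); [|exact: mpos|exact: measurable_funTS (mG _ _ _ _)].
  rewrite integral_mkcond [RHS]integral_mkcond.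
  apply: ae_eq_integral => //.
  + apply/(measurable_restrictT _ (mpos _ mq')); apply: measurable_funTS.
    by apply: emeasurable_funM; [exact: mG|exact/measurable_EFinP].
  + by apply/(measurable_restrictT _ (mpos _ mq))/measurable_funTS/mG.
  + apply: filterS2 ap aq => x /= /(_ I)[ppr] /(_ I)[qqr] _.
    rewrite !patchE !memb.
    have [rx0|rx0] := eqVneq (r x) 0%R.
      have [_ qx0] := rp _ rx0; rewrite qx0 ltxx rx0 mule0.
      by case: ifP.
    rewrite (rq _ qqr rx0); case: ifPn => // q'x.
    rewrite -muleA -EFinM -qqr; congr (fext f _ * _).
    by rewrite ppr qqr -mulf_div divff// mulr1.
- apply: (etrans (p'E _ (mzero _ mq'))); apply/esym.
  apply: (etrans (pE _ (mzero _ mq))); apply/esym.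
  rewrite (integral_density dr (mzero _ mq')); last first.
    exact/measurable_EFinP/measurable_funTS.
  rewrite integral_mkcond [RHS]integral_mkcond.
  apply: ae_eq_integral => //.
  + apply/(measurable_restrictT _ (mzero _ mq')); apply: measurable_funTS.
    by apply: emeasurable_funM; exact/measurable_EFinP.
  + by apply/(measurable_restrictT _ (mzero _ mq))/measurable_funTS/measurable_EFinP.
  + apply: filterS2 ap aq => x /= /(_ I)[ppr] /(_ I)[qqr] _.
    rewrite !patchE !mem0.
    have [rx0|rx0] := eqVneq (r x) 0%R.
      have [-> _] := rp _ rx0; rewrite rx0 mule0.
      by do 2 case: ifP.
    by rewrite (rq _ qqr rx0) -EFinM -ppr.
Qed.

End density_lemmas.

Section bernoulli.
Context (R : realType).

Let mu : {finite_measure set bool -> \bar R} :=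
  msum2 (\d_true : probability bool R) (\d_false : probability bool R).

Let muE B : mu B = \d_true B + \d_false B. Proof. exact: measure_addE. Qed.

Let integral_mu1 (c : bool) (g : bool -> \bar R) :
  \int[mu]_(x in [set c]) g x = g c.
Proof.
rewrite (eq_integral (cst (g c))); last by move=> x; rewrite inE => ->.
rewrite integral_cst// [X in _ * X]muE !diracE.
by case: c; rewrite !in_set1/= ?adde0 ?add0e mule1.
Qed.

Let density_bernoulli (a : R) : (0 <= a <= 1)%R ->
  is_density mu (bernoulli_prob a) (bernoulli_pmf a).
Proof.
move=> a01; split=> [//|x|B mB]; first exact: bernoulli_pmf_ge0.
rewrite bernoulli_probE// ge0_integral_measure_add//=; last first.
  by move=> x _; rewrite lee_fin bernoulli_pmf_ge0.
by rewrite !integral_dirac//= [in RHS]muleC; congr (_ + _); rewrite muleC.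
Qed.

Lemma fdiv_bernoulli (f : R -> R) (a b : R) :
  convex_function (E := R^o) `]0%R, +oo[%classic f ->
  (0 <= a <= 1)%R -> (0 <= b <= 1)%R ->
  fdiv f (bernoulli_prob a) (bernoulli_prob b) = phi_f f a b.
Proof.
move=> cf a01 b01.
rewrite (fdiv_density_indep cf (density_bernoulli a01) (density_bernoulli b01)).
rewrite /fdiv_density /phi_f.
have [b0|b0] := eqVneq b 0%R.
  have -> : [set x | (0 < bernoulli_pmf b x)%R] = [set false].
    by apply/seteqP; split => -[] //=; rewrite b0 ?ltxx// subr0.
  have -> : [set x | bernoulli_pmf b x = 0%R] = [set true].
    apply/seteqP; split => -[] //=; rewrite b0 subr0 => /eqP.
    by rewrite oner_eq0.
  rewrite integral_mu1/= b0 subr0 divr1 mule1 bernoulli_probE// !diracE.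
  by rewrite !in_set1/= mule0 adde0 mule1 muleC.
have [b1|b1] := eqVneq b 1%R.
  have -> : [set x | (0 < bernoulli_pmf b x)%R] = [set true].
    by apply/seteqP; split => -[] //=; rewrite b1 ?subrr ?ltxx.
  have -> : [set x | bernoulli_pmf b x = 0%R] = [set false].
    apply/seteqP; split => -[] //=; rewrite b1 ?subrr// => /eqP.
    by rewrite oner_eq0.
  rewrite integral_mu1/= b1 divr1 mule1 bernoulli_probE// !diracE.
  by rewrite !in_set1/= mule0 add0e mule1 muleC.
have [b_ge0 b_le1] := andP b01.
have b_gt0 : (0 < b)%R by rewrite lt_neqAle eq_sym b0.
have b_lt1 : (0 < 1 - b)%R by rewrite subr_gt0 lt_neqAle b1.
have -> : [set x | (0 < bernoulli_pmf b x)%R] = [set true] `|` [set false].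
  by apply/seteqP; split => -[] //= _; [left|right].
have -> : [set x | bernoulli_pmf b x = 0%R] = set0.
  by apply/seteqP; split => -[] //= /eqP; rewrite gt_eqF.
rewrite measure0 mule0 adde0 integral_setU//; last first.
  by apply/disj_setPRL => -[].
by rewrite !integral_mu1/= [in RHS]muleC; congr (_ + _); rewrite muleC.
Qed.

End bernoulli.

(* Main.v *)
From HB Require Import structures.
Require Import Defs.
From mathcomp Require Import all_boot all_order all_algebra.
From mathcomp Require Import all_classical all_reals all_analysis.
From mathcomp Require Import measurable_realfun.
From mathcomp Require Import ring lra.

(** The proof is dual: f is only ever used through its affine minorants
    [y |-> a + b * y], in particular through its support lines, whose intercept
    and slope at [u] are written i(u) and s(u) below.

    Integrating minorants A(x) + B(x) y <= f(y) that vary with x gives the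
    variational bound E_Q[A] + E_P[B] <= D_f(P || Q)
    ([fdiv_variational_bound]).  For a decision rule delta, a parameter theta
    and 0 < u <= 1 <= v, use the support line at u where delta errs
    (L(theta, delta(x)) = 1) and the support line at v elsewhere.  The bound on
    D_f(P_theta || Q) is then affine in the error probabilities of delta under
    P_theta and under Q, so integrating it against the prior needs no joint
    convexity of the divergence ([two_point_bound]).  The result involves the
    risk r of delta and the mean loss r' of delta when the data are drawn from
    Q independently of theta:

      i(v) + s(v) + (i(u) - i(v)) r' - (s(v) - s(u)) r <= I.

    Averaging over theta first shows r' >= R_0, because for each x the action
    delta(x) is chosen without knowledge of theta
    ([no_data_risk_le_independent]).  Slopes increase and intercepts decrease
    along a convex function, so both coefficients in brackets are nonnegative:
    r' may be lowered to R_0, and r may be replaced by its infimum, the Bayes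
    risk R.  What remains is

      R_0 i(u) + R s(u) + (1 - R_0) i(v) + (1 - R) s(v) <= I.

    Since R <= R_0, the choice u = R / R_0 and v = (1 - R) / (1 - R_0) is
    allowed and turns the left-hand side into phi_f(R, R_0).  If R = 0 or
    R_0 = 1 one of the two points is lost to 0 or infinity;
    then the supremum over u or v replaces the choice, as i(u) tends to f(0) when u -> 0 and s(v) tends to
    f'(oo) when v -> oo ([phi_f_le]).

    The divergence D_f(P_theta || Q) need not be measurable in theta.  The
    integral is built from suprema over simple functions, hence monotone
    without any measurability ([le_integral_pointwise]), and the integrals that
    are computed exactly are those of the measurable lower bounds. *)

Set Implicit Arguments.
Unset Strict Implicit.
Import Order.TTheory GRing.Theory Num.Theory.
Import numFieldNormedType.Exports.
Local Open Scope classical_set_scope.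
Local Open Scope ring_scope.
Local Open Scope ereal_scope.

(** * Support lines of a convex function *)

Section support_lines.
Local Open Scope ring_scope.
Context {R : realType} (f : R -> R).
Hypothesis f_convex : convex_function (E := R^o) `]0%R, +oo[%classic f.

Lemma convex_three_points (x y z : R) : 0 < x -> x < y -> y < z ->
  (z - x) * f y <= (z - y) * f x + (y - x) * f z.
Proof.
move=> x0 xy yz.
have zx0 : 0 < z - x by rewrite subr_gt0 (lt_trans xy).
have t0 : 0 <= (z - y) / (z - x) by apply: divr_ge0; lra.
have t1 : (z - y) / (z - x) <= 1 by rewrite ler_pdivrMr//; lra.
have := @f_convex (Itv01 t0 t1) x z.
rewrite !inE/= !in_itv/= !andbT => /(_ x0 (lt_trans x0 (lt_trans xy yz))).
set t := (z - y) / (z - x) => fy.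
have {fy} : f (t * x + (1 - t) * z) <= t * f x + (1 - t) * f z by exact: fy.
have tE : t * (z - x) = z - y by rewrite /t divfK// gt_eqF.
have -> : t * x + (1 - t) * z = y.
  apply/eqP; rewrite -subr_eq0 [X in X == _](_ : _ = z - y - t * (z - x)).
    by rewrite tE subrr.
  by ring.
move=> /(ler_wpM2l (ltW zx0)) /le_trans; apply.
rewrite [leLHS](_ : _ = t * (z - x) * f x + ((z - x) - t * (z - x)) * f z); last by ring.
by rewrite tE [X in X * f z](_ : _ = y - x)//; ring.
Qed.

(** This is the left derivative at [u]: left difference quotients increase to
    their supremum, and they are bounded above by the right ones. *)
Definition support_slope (u : R) : R :=
  sup [set (f u - f x) / (u - x) | x in `]0, u[%classic].

Definition support_intercept (u : R) : R := f u - support_slope u * u.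

Definition affine_minorant (a b : R) : Prop := forall x, 0 < x -> a + b * x <= f x.

Lemma support_line_minorant u : 0 < u ->
  affine_minorant (support_intercept u) (support_slope u).
Proof.
move=> u0 x x0; rewrite /support_intercept.
rewrite [leLHS](_ : _ = f u + support_slope u * (x - u)); last by ring.
set S := [set (f u - f y) / (u - y) | y in `]0, u[%classic].
have ub z : u < z -> ubound S ((f z - f u) / (z - u)).
  move=> uz r [y /=]; rewrite in_itv/= => /andP[y0 yu] <-{r}.
  rewrite ler_pdivrMr ?subr_gt0// mulrAC ler_pdivlMr ?subr_gt0//.
  by have := convex_three_points y0 yu uz; lra.
have S0 : S !=set0.
  by exists ((f u - f (u / 2)) / (u - u / 2)), (u / 2) => //=; rewrite in_itv/=; lra.
have [xu|ux|->] := ltgtP x u; last by rewrite subrr mulr0 addr0.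
- have : (f u - f x) / (u - x) <= support_slope u.
    apply: ub_le_sup; last by exists x => //=; rewrite in_itv/= x0.
    by exists ((f (u + 1) - f u) / (u + 1 - u)); apply: ub; lra.
  by rewrite ler_pdivrMr ?subr_gt0//; lra.
- have : support_slope u <= (f x - f u) / (x - u) by apply: ge_sup => //; exact: ub.
  by rewrite ler_pdivlMr ?subr_gt0//; lra.
Qed.

Lemma support_line_at u : support_intercept u + support_slope u * u = f u.
Proof. by rewrite subrK. Qed.

Lemma support_slope_le u v : 0 < u -> u <= v ->
  support_slope u <= support_slope v.
Proof.
move=> u0; rewrite le_eqVlt => /predU1P[->//|uv].
have v0 := lt_trans u0 uv.
have h1 := support_line_minorant u0 v0; have h2 := support_line_minorant v0 u0.
have e1 := support_line_at u; have e2 := support_line_at v.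
rewrite -subr_ge0 -(pmulr_lge0 _ (_ : 0 < v - u)) ?subr_gt0//.
lra.
Qed.

Lemma support_intercept_ge u v : 0 < u -> u <= v ->
  support_intercept v <= support_intercept u.
Proof.
move=> u0 uv; have v0 := lt_le_trans u0 uv.
have h2 := support_line_minorant v0 u0; have e1 := support_line_at u.
have := ler_wpM2r (ltW u0) (support_slope_le u0 uv).
lra.
Qed.

End support_lines.

(** * The values of f at zero and of its slope at infinity *)

Section extension_limits.
Context {R : realType} (f : R -> R).
Hypothesis f_convex : convex_function (E := R^o) `]0%R, +oo[%classic f.
Hypothesis f1 : f 1%R = 0%R.

(* As f(1) = 0, this is the slope of the chord from 1 to u; by convexity it is
   monotone, which is where both limits come from. *)
Let chord (u : R) : R := (f u / (u - 1))%R.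

Let chord_le x y : (0 < x)%R -> (x <= y)%R -> x != 1%R -> y != 1%R ->
  (chord x <= chord y)%R.
Proof.
move=> x0; rewrite le_eqVlt => /predU1P[->//|xy] x1 y1; rewrite /chord.
have c := convex_three_points f_convex.
have [{}x1|{}x1|] := ltgtP x 1%R; last by move/eqP: x1.
- have x1' : (0 < 1 - x)%R by rewrite subr_gt0.
  have -> : (f x / (x - 1) = - f x / (1 - x))%R by rewrite -(opprB 1%R x) invrN mulrN mulNr.
  have [{}y1|{}y1|] := ltgtP y 1%R; last by move/eqP: y1.
  + have -> : (f y / (y - 1) = - f y / (1 - y))%R by rewrite -(opprB 1%R y) invrN mulrN mulNr.
    rewrite ler_pdivrMr// mulrAC ler_pdivlMr ?subr_gt0//.
    by have := c _ _ _ x0 xy y1; rewrite f1; lra.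
  + rewrite ler_pdivrMr// mulrAC ler_pdivlMr ?subr_gt0//.
    by have := c _ _ _ x0 x1 y1; rewrite f1; lra.
- have y1' : (1 < y)%R by exact: lt_trans xy.
  rewrite ler_pdivrMr ?subr_gt0// mulrAC ler_pdivlMr ?subr_gt0//.
  by have := c _ _ _ ltr01 x1 xy; rewrite f1; lra.
Qed.

Let mule_def1 (x : \bar R) : x *? 1.
Proof. by case: x => [r||] //; exact: oner_neq0. Qed.

(** The quotient is minus the slope of the chord from 1 to u, so it increases
    as u decreases to 0, and the factor 1 - u by which it differs from f(u)
    tends to 1. *)
Lemma cvg_fext0 : (f y)%:E @[y --> 0%R^'+] -->
  ereal_sup [set (f u / (1 - u))%:E | u in `]0%R, 1%R[%classic].
Proof.
pose g u := (f u / (1 - u))%:E.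
have gE u : g u = (- chord u)%:E.
  by rewrite /g /chord -(opprB u 1%R) invrN mulrN.
have gcvg : g u @[u --> 0%R^'+] --> ereal_sup [set g u | u in `]0%R, 1%R[%classic].
  apply: (@nonincreasing_at_right_cvge _ _ 0%R (BLeft 1%R)) => [|x y].
    by rewrite bnd_simp.
  rewrite !in_itv/= => /andP[x0 x1] /andP[y0 y1] xy.
  by rewrite !gE lee_fin lerN2 chord_le// lt_eqF.
have hcvg : (1 - u)%:E @[u --> (0%R:R)^'+] --> 1%:E.
  apply/cvg_EFin; first by near=> u.
  rewrite -[X in _ --> X](subr0 1%R); apply: cvg_at_right_filter.
  by apply: cvgB; [exact: cvg_cst|exact: cvg_id].
have := cvgeM (mule_def1 _) gcvg hcvg; rewrite mule1 => /(_ _)gh.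
apply: cvg_trans gh; apply: near_eq_cvg; near=> u; rewrite /g/= -EFinM divfK//.
by rewrite subr_eq0 eq_sym lt_eqF//; near: u; exact: nbhs_right_lt.
Unshelve. all: by end_near. Qed.

(** Chord slopes from 1 increase with the other end point; truncating at 2 keeps
    away from the singularity at 1 and makes the function monotone on the whole
    line without changing the limit. *)
Lemma cvg_fslope_oo : (f y / y)%:E @[y --> +oo%R] -->
  ereal_sup (range (fun y => (f (Num.max y 2) / (Num.max y 2 - 1))%:E)).
Proof.
pose g u := (chord (Num.max u 2%R))%:E.
have gcvg : g u @[u --> +oo%R] --> ereal_sup (range g).
  apply: nondecreasing_cvge => x y xy; rewrite lee_fin chord_le//.
  - by rewrite lt_max ltr0n orbT.
  - by rewrite ge_max !le_max xy lexx orbT.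
  - by rewrite gt_eqF// lt_max ltr1n orbT.
  - by rewrite gt_eqF// lt_max ltr1n orbT.
have hcvg : (1 - u^-1)%:E @[u --> (+oo:set_system R)%R] --> 1%:E.
  apply/cvg_EFin; first by near=> u.
  rewrite -[X in _ --> X](subr0 1%R).
  apply: cvgB; [exact: cvg_cst|].
  apply/(gtr0_cvgV0 (a := +oo%R) (f := id)); last exact: cvg_id.
  by near=> u; near: u; exact: nbhs_pinfty_gt.
have := cvgeM (mule_def1 _) gcvg hcvg; rewrite mule1 => /(_ _)gh.
apply: cvg_trans gh; apply: near_eq_cvg; near=> u; rewrite /g/= -EFinM; congr EFin.
have u2 : (2 < u)%R by near: u; exact: nbhs_pinfty_gt.
have -> : Num.max u 2%R = u by apply/max_idPl/ltW.
rewrite /chord; field.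
by rewrite subr_eq0 !gt_eqF//; lra.
Unshelve. all: by end_near. Qed.

Lemma minorant_le_fext a b y : affine_minorant f a b -> (0 <= y)%R ->
  (a + b * y)%:E <= fext f y.
Proof.
move=> ab; rewrite /fext le_eqVlt => /predU1P[<-|y0]; last by rewrite y0 lee_fin ab.
have acvg : (a + b * u)%:E @[u --> (0%R:R)^'+] --> (a + b * 0)%:E.
  apply/cvg_EFin; first by near=> u.
  apply: cvg_at_right_filter; apply: cvgD; first exact: cvg_cst.
  by apply: cvgM; [exact: cvg_cst|exact: cvg_id].
rewrite ltxx -(cvg_lim _ acvg)//; apply: lee_lim.
- by apply/cvg_ex; eexists; exact: acvg.
- by apply/cvg_ex; eexists; exact: cvg_fext0.
- by near=> u; rewrite lee_fin ab//; near: u; exact: nbhs_right_gt.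
Unshelve. all: by end_near. Qed.

Lemma minorant_slope_le a b : affine_minorant f a b -> b%:E <= fslope_oo f.
Proof.
move=> ab.
have bcvg : (a * u^-1 + b)%:E @[u --> (+oo:set_system R)%R] --> b%:E.
  apply/cvg_EFin; first by near=> u.
  rewrite -[X in _ --> X](add0r b) -[X in _ --> (X + _)%R](mulr0 a).
  apply: cvgD; [apply: cvgM|]; [exact: cvg_cst| |exact: cvg_cst].
  apply/(gtr0_cvgV0 (a := +oo%R) (f := id)); last exact: cvg_id.
  by near=> u; near: u; exact: nbhs_pinfty_gt.
rewrite -(cvg_lim _ bcvg)//; apply: lee_lim.
- by apply/cvg_ex; eexists; exact: bcvg.
- by apply/cvg_ex; eexists; exact: cvg_fslope_oo.
- near=> u; have u0 : (0 < u)%R by near: u; exact: nbhs_pinfty_gt.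
  rewrite lee_fin ler_pdivlMr// mulrDl divfK ?gt_eqF//; exact: ab.
Unshelve. all: by end_near. Qed.

(** A support line at u < 1 lies below 0 = f(1) at 1, so its intercept is at
    least f(u) / (1 - u): intercepts at small u reach f(0), even when it is
    infinite. *)
Lemma fext0_le y :
  (forall u, (0 < u <= 1)%R -> (support_intercept f u)%:E <= y) -> fext f 0 <= y.
Proof.
move=> h; rewrite /fext ltxx (cvg_lim _ cvg_fext0)//.
apply: ge_ereal_sup => r [u /=]; rewrite in_itv/= => /andP[u0 u1] <-{r}.
apply: le_trans (h u _); last by rewrite u0 ltW.
rewrite lee_fin ler_pdivrMr ?subr_gt0//.
have := support_line_minorant f_convex u0 ltr01; rewrite f1 mulr1.
have := support_line_at f u => e le0; rewrite -e.
have := ler_wpM2r (ltW u0) le0; lra.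
Qed.

(** A support line at v > 1 lies below 0 = f(1) at 1, so its slope is at least
    that of the chord from 1 to v. *)
Lemma fslope_oo_le y :
  (forall v, (1 <= v)%R -> (support_slope f v)%:E <= y) -> fslope_oo f <= y.
Proof.
move=> h; rewrite /fslope_oo (cvg_lim _ cvg_fslope_oo)//.
apply: ge_ereal_sup => _ [u _ <-].
have v1 : (1 < Num.max u 2)%R by rewrite lt_max ltr1n orbT.
move: (Num.max u 2)%R v1 => v v1.
apply: le_trans (h v _); last exact: ltW.
rewrite lee_fin ler_pdivrMr ?subr_gt0//.
have := support_line_minorant f_convex (lt_trans ltr01 v1) ltr01.
rewrite f1 mulr1; have := support_line_at f v; lra.
Qed.

End extension_limits.

(** * The binary divergence as a supremum over pairs of support lines *)

Section binary_divergence.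
Context {R : realType} (f : R -> R).
Hypothesis f_convex : convex_function (E := R^o) `]0%R, +oo[%classic f.
Hypothesis f1 : f 1%R = 0%R.

(* The perspective (a, b) |-> b f(a / b) is the supremum of these forms,
   attained at u = a / b. *)
Let line u a b : R := (b * support_intercept f u + a * support_slope f u)%R.

Let line_at a b : b != 0%R -> line (a / b) a b = (b * f (a / b))%R.
Proof. by move=> b0; rewrite -(support_line_at f (a / b)) /line; field. Qed.

Let le_pmul_fin (k c : R) (z : \bar R) : (0 < k)%R ->
  z <= (c / k)%:E -> k%:E * z <= c%:E.
Proof.
move=> k0 /(lee_wpmul2l (x := k%:E)) h; apply: le_trans (h _) _.
  by rewrite lee_fin ltW.
by rewrite -EFinM mulrC divfK ?gt_eqF.
Qed.

(** When a = 0 the point u = a / b is not available and f(0) is reached through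
    the intercepts as u tends to 0.  Only u <= 1 is needed because a <= b. *)
Lemma perspective_fext_le a b c : (0 <= a <= b)%R -> (0 < b)%R ->
  (forall u, (0 < u <= 1)%R ->
     (b * support_intercept f u + a * support_slope f u <= c)%R) ->
  b%:E * fext f (a / b) <= c%:E.
Proof.
move=> /andP[a0 ab] b0 h; move: a0; rewrite le_eqVlt => /predU1P[a0|a0].
- subst a; rewrite mul0r; apply: le_pmul_fin => //.
  apply: fext0_le => // u u01; rewrite lee_fin ler_pdivlMr// mulrC.
  by have := h _ u01; rewrite mul0r addr0.
- rewrite /fext divr_gt0// -EFinM lee_fin -line_at ?gt_eqF//.
  by apply: h; rewrite divr_gt0//= ler_pdivrMr// mul1r.
Qed.

(** When b = 0 the point v = a / b is infinite and the slope at infinity is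
    reached through the slopes at large v.  Only v >= 1 is needed because
    b <= a. *)
Lemma perspective_slope_le a b c : (0 <= b <= a)%R ->
  (forall v, (1 <= v)%R ->
     (b * support_intercept f v + a * support_slope f v <= c)%R) ->
  (if b == 0%R then a%:E * fslope_oo f else b%:E * fext f (a / b)) <= c%:E.
Proof.
move=> /andP[b0 ba] h; have [b0'|bn0] := eqVneq b 0%R.
- subst b; move: ba; rewrite le_eqVlt => /predU1P[a0|a0].
    by subst a; rewrite mul0e lee_fin; have := h 1%R (lexx _); rewrite !mul0r addr0.
  apply: le_pmul_fin => //.
  apply: fslope_oo_le => // v v1; rewrite lee_fin ler_pdivlMr// mulrC.
  by have := h _ v1; rewrite mul0r add0r.
- have {}b0 : (0 < b)%R by rewrite lt_neqAle eq_sym bn0.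
  have a0 := lt_le_trans b0 ba.
  rewrite /fext divr_gt0// -EFinM lee_fin -line_at//.
  by apply: h; rewrite ler_pdivlMr// mul1r.
Qed.

(** The points u and v are optimized independently: each of the two terms of
    phi_f is the supremum of its own family of support lines. *)
Lemma phi_f_le a b y : (0 <= a <= b)%R -> (0 < b <= 1)%R ->
  (forall u v, (0 < u <= 1)%R -> (1 <= v)%R ->
     (b * support_intercept f u + a * support_slope f u +
      ((1 - b) * support_intercept f v + (1 - a) * support_slope f v))%:E <= y) ->
  phi_f f a b <= y.
Proof.
move=> /andP[a0 ab] /andP[b0 b1]; have one : (0 < (1 : R) <= 1)%R by rewrite ltr01 lexx.
case: y => [y| |] h; [|exact: leey|by have := h _ _ one (lexx 1%R)].
have -> : phi_f f a b = b%:E * fext f (a / b) +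
    (if (1 - b == 0)%R then (1 - a)%:E * fslope_oo f
     else (1 - b)%:E * fext f ((1 - a) / (1 - b))).
  rewrite /phi_f (gt_eqF b0) subr_eq0 (eq_sym 1%R b).
  by have [->|//] := eqVneq b 1%R; rewrite mul1e divr1.
(* With v fixed the supremum over u bounds the first term; the first term being
   then a number, the supremum over v bounds the second one. *)
set s2 := (if _ then _ else _).
have ab01 : (0 <= a <= b)%R by rewrite a0.
have first v : (1 <= v)%R -> b%:E * fext f (a / b) <= (y - line v (1 - a) (1 - b))%:E.
  move=> v1; apply: perspective_fext_le => //.
  by move=> u u01; have := h _ _ u01 v1; rewrite lee_fin -lerBrDr.
move: first; set s1 := b%:E * _ => first.
have : s1 < +oo by exact: le_lt_trans (first _ (lexx _)) (ltry _).
move: first; case: s1 => [r| |] // first _; last by rewrite addNye leNye.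
rewrite -leeBrDl// -EFinB; apply: perspective_slope_le.
  by rewrite subr_ge0 b1 lerD2l lerN2.
by move=> v v1; have := first _ v1; rewrite lee_fin /line; lra.
Qed.

End binary_divergence.

(** * A variational lower bound on the divergence *)

(** Neither function has to be measurable: the integrals of positive and
    negative parts are suprema over the simple functions below them. *)
Lemma le_integral_pointwise {d} {T : measurableType d} {R : realType}
    (mu : {measure set T -> \bar R}) (D : set T) (f g : T -> \bar R) :
  (forall x, D x -> f x <= g x) -> \int[mu]_(x in D) f x <= \int[mu]_(x in D) g x.
Proof.
move=> fg; have fgD x : (f \_ D) x <= (g \_ D) x.
  by rewrite !patchE; case: ifPn => // /set_mem /fg.
rewrite /integral; apply: leeB; apply: ereal_sup_le => _ [h /= hf <-];
  exists h => // x; apply: le_trans (hf x) _.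
- by rewrite !funeposE ge_max !le_max fgD lexx orbT.
- by rewrite !funenegE ge_max !le_max leeN2 fgD lexx orbT.
Qed.

Section variational_bound.
Context {d} {X : measurableType d} {R : realType} (f : R -> R).
Hypothesis f_convex : convex_function (E := R^o) `]0%R, +oo[%classic f.
Hypothesis f1 : f 1%R = 0%R.

Let integrable_density (mu : {sigma_finite_measure set X -> \bar R})
    (nu : {finite_measure set X -> \bar R}) (r A : X -> R) (D : set X) :
  is_density mu nu r -> measurable D -> nu.-integrable D (EFin \o A) ->
  mu.-integrable D (EFin \o (A \* r)%R).
Proof.
move=> dr mD /integrableP[mA Aoo]; have [mr r0 _] := dr.
apply/integrableP; split.
  apply/measurable_EFinP/measurable_funM; first exact/measurable_EFinP.
  exact: measurable_funTS.
apply: le_lt_trans Aoo; rewrite (ge0_integral_density dr)//; last first.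
  exact: measurableT_comp.
by apply: le_integral_pointwise => x _ /=; rewrite normrM (ger0_norm (r0 x)).
Qed.

(** Where q > 0, multiply A + B y <= f(y) by q at y = p / q.  Where q = 0, the
    measure Q has no mass and the slope of every minorant is at most the slope
    at infinity, which is the weight that the divergence gives to P there. *)
Lemma fdiv_variational_bound (P Q : probability X R) (A B : X -> R) :
  Q.-integrable setT (EFin \o A) -> P.-integrable setT (EFin \o B) ->
  (forall x, affine_minorant f (A x) (B x)) ->
  \int[Q]_x (A x)%:E + \int[P]_x (B x)%:E <= fdiv f P Q.
Proof.
move=> iA iB AB.
have Pnu : P `<< msum2 P Q.
  move=> C C0 E mE EC; have := C0 _ mE EC; rewrite /msum2/= measure_addE => /eqP.
  by rewrite padde_eq0// => /andP[/eqP].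
have Qnu : Q `<< msum2 P Q.
  move=> C C0 E mE EC; have := C0 _ mE EC; rewrite /msum2/= measure_addE => /eqP.
  by rewrite padde_eq0// => /andP[_ /eqP].
have dp : is_density (msum2 P Q) P (density_msum2 P Q P) := density_RN Pnu.
have dq : is_density (msum2 P Q) Q (density_msum2 P Q Q) := density_RN Qnu.
rewrite /fdiv /fdiv_density; move: (density_msum2 P Q P) dp => p dp.
move: (density_msum2 P Q Q) dq => q dq.
have [mp p0 pE] := dp; have [mq q0 qE] := dq.
set D := [set x | (0 < q x)%R]; set N := [set x | q x = 0%R].
have mD : measurable D.
  rewrite -[D]setTI; have mb : measurable_fun setT (fun x => (0 < q x)%R).
    exact: measurable_fun_ltr.
  exact: (mb measurableT [set true]).
have mN : measurable N.
  by rewrite -[N]setTI; exact: (mq measurableT [set 0%R]).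
have DN : [set: X] = D `|` N.
  apply/seteqP; split => // x _; have := q0 x; rewrite le_eqVlt => /predU1P[|].
    by right.
  by left.
have disj : [disjoint D & N].
  by apply/disj_setPS => x [] qx qx0; move: qx; rewrite /D /= (qx0 : q x = 0%R) ltxx.
have QN : Q N = 0 by rewrite qE//; apply: integral0_eq => x ->.
have split_int (mu : probability X R) (C : X -> R) :
    mu.-integrable setT (EFin \o C) ->
    \int[mu]_x (C x)%:E = \int[mu]_(x in D) (C x)%:E + \int[mu]_(x in N) (C x)%:E.
  by move=> /(@measurable_int _ _ _ _ _ _) mC; rewrite DN integral_setU// -DN.
rewrite (split_int Q A)// (split_int P B)//.
rewrite [X in _ + X + _](null_set_integral mN _ QN) ?adde0; last first.
  exact: measurable_funS measurableT _ (measurable_int _ iA).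
rewrite addeA; apply: leeD.
- have iAD := integrableS measurableT mD (@subsetT _ _) iA.
  have iBD := integrableS measurableT mD (@subsetT _ _) iB.
  rewrite (integral_density dq)//; last exact: measurable_int iAD.
  rewrite (integral_density dp)//; last exact: measurable_int iBD.
  rewrite -(integralD mD (integrable_density dq mD iAD) (integrable_density dp mD iBD)).
  apply: le_integral_pointwise => x /= qx.
  have := minorant_le_fext f_convex f1 (AB x) (divr_ge0 (p0 x) (ltW qx)).
  move=> /(@lee_wpmul2r _ (q x)%:E _); rewrite lee_fin => /(_ (ltW qx)).
  by rewrite -!EFinM -EFinD mulrDl -mulrA divfK ?gt_eqF.
- rewrite -integral_cst//; apply: le_integral_pointwise => x _.
  exact: minorant_slope_le (AB x).
Qed.

End variational_bound.

(** * Averaging the bound over the parameter *)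

Lemma fin_num_unit_interval {R : realType} (y : \bar R) :
  0 <= y <= 1 -> y \is a fin_num.
Proof. by move=> /andP[y0 y1]; rewrite ge0_fin_numE// (le_lt_trans y1)// ltry. Qed.

Section unit_interval_integrals.
Context {d} {T : measurableType d} {R : realType} (mu : probability T R).
Implicit Type g : T -> R.

Lemma integrable_unit_interval g : measurable_fun setT g ->
  (forall x, (0 <= g x <= 1)%R) -> mu.-integrable setT (EFin \o g).
Proof.
move=> mg g01; apply: measurable_bounded_integrable => //.
  exact: le_lt_trans (probability_le1 mu measurableT) (ltry _).
exists 1%R; split => // M M1 x _; have /andP[g0 g1] := g01 x.
by rewrite /= ger0_norm// (le_trans g1)// ltW.
Qed.

Lemma integral_unit_interval (g : T -> \bar R) :
  (forall x, 0 <= g x <= 1) -> 0 <= \int[mu]_x g x <= 1.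
Proof.
move=> g01; apply/andP; split.
  by apply: integral_ge0 => x _; case/andP: (g01 x).
apply: le_trans (le_integral_pointwise (g := cst 1) _ _) _ => [x _|].
  by case/andP: (g01 x).
by rewrite integral_cst// mul1e; exact: probability_le1.
Qed.

Lemma integrable_affine g (c k : R) : mu.-integrable setT (EFin \o g) ->
  mu.-integrable setT (EFin \o (fun x => c + k * g x)%R).
Proof.
move=> ig; have ic : mu.-integrable setT (fun=> c%:E).
  exact: finite_measure_integrable_cst.
exact: (integrableD measurableT ic (integrableZl measurableT k ig)).
Qed.

Lemma integral_affine g (c k : R) : mu.-integrable setT (EFin \o g) ->
  \int[mu]_x (c + k * g x)%:E = (c + k * fine (\int[mu]_x (g x)%:E))%:E.
Proof.
move=> ig; have ic : mu.-integrable setT (fun=> c%:E).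
  exact: finite_measure_integrable_cst.
have fi := integrable_fin_num measurableT ig.
rewrite (integralD_EFin measurableT ic (integrableZl measurableT k ig)).
rewrite integral_cst// [X in _ * X](probability_setT mu) mule1.
by rewrite [X in _ + X](integralZl measurableT ig k) EFinD EFinM fineK.
Qed.

End unit_interval_integrals.

Section decision_rules.
Context {R : realType} {dT dX : measure_display}.
Context {Theta : measurableType dT} {X : measurableType dX}.
Context (P : Theta -> probability X R) (w : probability Theta R).
Hypothesis P_measurable : forall B : set X, measurable B ->
  measurable_fun setT (fun t => P t B).

(* The family [P] seen as a probability kernel. *)
Let k (t : Theta) : {measure set X -> \bar R} := P t.

HB.instance Definition _ := isKernel.Build _ _ _ _ _ k P_measurable.

Let k_prob t : k t setT = 1. Proof. exact: probability_setT. Qed.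

HB.instance Definition _ := Kernel_isProbability.Build _ _ _ _ _ k k_prob.

Lemma measurable_kernel_mean (phi : Theta * X -> R) :
  measurable_fun setT phi -> (forall z, 0 <= phi z)%R ->
  measurable_fun setT (fun t => \int[P t]_x (phi (t, x))%:E).
Proof.
move=> mphi phi0.
by apply: (@measurable_fun_integral_finite_kernel _ _ _ _ _ (EFin \o phi) k) => //;
  exact/measurable_EFinP.
Qed.

Context (f : R -> R).
Hypothesis f_convex : convex_function (E := R^o) `]0%R, +oo[%classic f.
Hypothesis f1 : f 1%R = 0%R.

(** The values of [phi] mix the two minorants, so that [phi] acts as a randomized
    test between them; for a rule under a zero-one loss it is the indicator of
    an error.  The bound obtained for each parameter is affine in the means of
    [phi], and integration commutes with affine maps. *)
Lemma two_point_bound (Q : probability X R) (phi : Theta * X -> R) a1 b1 a0 b0 :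
  measurable_fun setT phi -> (forall z, 0 <= phi z <= 1)%R ->
  affine_minorant f a1 b1 -> affine_minorant f a0 b0 ->
  (a0 + b0 + (a1 - a0) * fine (\int[w]_t \int[Q]_x (phi (t, x))%:E) +
   (b1 - b0) * fine (\int[w]_t \int[P t]_x (phi (t, x))%:E))%:E
  <= \int[w]_t fdiv f (P t) Q.
Proof.
move=> mphi phi01 m1 m0.
have mphit t : measurable_fun setT (fun x => phi (t, x)).
  exact: measurableT_comp mphi (measurable_pair1 t).
have phi0 z : (0 <= phi z)%R by case/andP: (phi01 z).
pose b t := fine (\int[Q]_x (phi (t, x))%:E).
pose a t := fine (\int[P t]_x (phi (t, x))%:E).
have bE t : \int[Q]_x (phi (t, x))%:E = (b t)%:E.
  rewrite fineK//; apply: fin_num_unit_interval; apply: integral_unit_interval => x.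
  by rewrite !lee_fin phi01.
have aE t : \int[P t]_x (phi (t, x))%:E = (a t)%:E.
  rewrite fineK//; apply: fin_num_unit_interval; apply: integral_unit_interval => x.
  by rewrite !lee_fin phi01.
have b01 t : (0 <= b t <= 1)%R.
  by rewrite -!lee_fin -bE; apply: integral_unit_interval => x; rewrite !lee_fin phi01.
have a01 t : (0 <= a t <= 1)%R.
  by rewrite -!lee_fin -aE; apply: integral_unit_interval => x; rewrite !lee_fin phi01.
have mEphi : measurable_fun setT (EFin \o phi) by exact/measurable_EFinP.
have mb : measurable_fun setT b.
  apply/measurable_EFinP; rewrite (_ : _ \o _ = fun t => \int[Q]_x (phi (t, x))%:E).
    exact: (measurable_fun_fubini_tonelli_F (m2 := Q) (EFin \o phi)
      mEphi phi0).
  by apply/funext => t /=; rewrite bE.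
have ma : measurable_fun setT a.
  apply/measurable_EFinP; rewrite (_ : _ \o _ = fun t => \int[P t]_x (phi (t, x))%:E).
    exact: measurable_kernel_mean.
  by apply/funext => t /=; rewrite aE.
under [in leLHS]eq_integral do rewrite bE.
under [X in (_ + _ * fine X)%R%:E]eq_integral do rewrite aE.
have ib : w.-integrable setT (EFin \o b).
  exact: integrable_unit_interval.
have ia : w.-integrable setT (EFin \o a).
  exact: integrable_unit_interval.
have -> : (a0 + b0 + (a1 - a0) * fine (\int[w]_t (b t)%:E) +
    (b1 - b0) * fine (\int[w]_t (a t)%:E))%:E =
    \int[w]_t (a0 + (a1 - a0) * b t + (b0 + (b1 - b0) * a t))%:E.
  rewrite (integralD_EFin measurableT (integrable_affine _ _ ib) (integrable_affine _ _ ia)).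
  by rewrite !integral_affine// -EFinD; congr EFin; ring.
apply: le_integral_pointwise => t _.
have iQ : Q.-integrable setT (EFin \o (fun x => phi (t, x))).
  exact: integrable_unit_interval.
have iP : (P t).-integrable setT (EFin \o (fun x => phi (t, x))).
  exact: integrable_unit_interval.
have mix x : affine_minorant f (a0 + (a1 - a0) * phi (t, x)) (b0 + (b1 - b0) * phi (t, x)).
  move=> y y0; have /andP[p0 p1] := phi01 (t, x); move: (phi (t, x)) p0 p1 => p p0 p1.
  have p1' : (0 <= 1 - p)%R by rewrite subr_ge0.
  have := ler_wpM2l p0 (m1 y y0); have := ler_wpM2l p1' (m0 y y0); lra.
have := fdiv_variational_bound f_convex f1 (integrable_affine _ _ iQ)
  (integrable_affine _ _ iP) mix.
by rewrite !integral_affine.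
Qed.

End decision_rules.

(** * Risks *)

Section risk_bounds.
Context {R : realType} {dT dA dX : measure_display}.
Context {Theta : measurableType dT} {A : measurableType dA} {X : measurableType dX}.
Context (P : Theta -> probability X R) (w : probability Theta R) (L : Theta -> A -> R).
Hypothesis L_measurable : measurable_fun setT (fun z : Theta * A => L z.1 z.2).
Hypothesis L01 : forall t a, (0 <= L t a <= 1)%R.

Lemma measurable_loss_rule (delta : X -> A) : measurable_fun setT delta ->
  measurable_fun setT (fun z : Theta * X => L z.1 (delta z.2)).
Proof.
move=> mdelta.
apply: (measurableT_comp (f := fun z : Theta * A => L z.1 z.2)
  (g := fun z : Theta * X => (z.1, delta z.2))) => //.
by apply: measurable_fun_pair => //; exact: measurableT_comp.
Qed.

Lemma no_data_risk_itv : 0 <= no_data_risk w L <= 1.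
Proof.
have mean_itv a : 0 <= \int[w]_t (L t a)%:E <= 1.
  by apply: integral_unit_interval => t; rewrite !lee_fin L01.
apply/andP; split.
  by apply: le_ereal_inf_tmp => _ [a _ <-]; case/andP: (mean_itv a).
apply: (@le_trans _ _ (\int[w]_t (L t point)%:E)).
  by apply: ereal_inf_lbound; exists point.
by case/andP: (mean_itv point).
Qed.

Lemma rule_risk_itv (K : Theta -> probability X R) (delta : X -> A) :
  0 <= \int[w]_t \int[K t]_x (L t (delta x))%:E <= 1.
Proof.
apply: integral_unit_interval => t; apply: integral_unit_interval => x.
by rewrite !lee_fin L01.
Qed.

(** Constant rules ignore the data and have the risk of their action. *)
Lemma bayes_risk_itv : 0 <= bayes_risk w L P <= no_data_risk w L.
Proof.
apply/andP; split.
  by apply: le_ereal_inf_tmp => _ [delta _ <-]; case/andP: (rule_risk_itv P delta).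
apply: le_ereal_inf_tmp => _ [a _ <-]; apply: ereal_inf_lbound; exists (cst a) => //=.
apply: eq_integral => t _.
by rewrite integral_cst// [X in _ * X](probability_setT (P t)) mule1.
Qed.

(** Exchange the two integrals: for each x the inner one is the mean loss of the
    fixed action delta(x). *)
Lemma no_data_risk_le_independent (Q : probability X R) (delta : X -> A) :
  measurable_fun setT delta ->
  no_data_risk w L <= \int[w]_t \int[Q]_x (L t (delta x))%:E.
Proof.
move=> mdelta; have mL := measurable_loss_rule mdelta.
rewrite (fubini_tonelli (fun z : Theta * X => (L z.1 (delta z.2))%:E)); last 2 first.
- exact/measurable_EFinP.
- by move=> z; rewrite lee_fin; case/andP: (L01 z.1 (delta z.2)).
apply: (@le_trans _ _ (\int[Q]_x no_data_risk w L)).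
  by rewrite integral_cst// [X in _ * X](probability_setT Q) mule1.
by apply: le_integral_pointwise => x _; apply: ereal_inf_lbound; exists (delta x).
Qed.

End risk_bounds.

(** * The lower bound on the informativity *)

Theorem theorem3p2 (R : realType) (dTheta dA dX : measure_display)
    (Theta : measurableType dTheta) (A : measurableType dA)
    (X : measurableType dX)
    (P : Theta -> probability X R)
    (P_measurable : forall B : set X, measurable B ->
      measurable_fun setT (fun t => P t B))
    (w : probability Theta R)
    (L : Theta -> A -> R)
    (L_measurable : measurable_fun setT (fun z : Theta * A => L z.1 z.2))
    (L01 : forall t a, L t a = 0%R \/ L t a = 1%R)
    (R0_gt0 : 0 < no_data_risk w L)
    (f : R -> R)
    (f_convex : convex_function (E := R^o) `]0%R, +oo[%classic f)
    (f1 : f 1%R = 0%R) :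
  phi_f f (fine (bayes_risk w L P)) (fine (no_data_risk w L))
    <= f_informativity f w P.
Proof.
have L_itv t a : (0 <= L t a <= 1)%R by case: (L01 t a) => ->; rewrite lexx ler01.
have /andP[R0_ge0 R0_le1] := no_data_risk_itv w L_itv.
have /andP[RB_ge0 RB_leR0] := bayes_risk_itv P w L_itv.
have R0_fin : no_data_risk w L \is a fin_num.
  by apply: fin_num_unit_interval; rewrite R0_ge0.
have RB_fin : bayes_risk w L P \is a fin_num.
  by apply: fin_num_unit_interval; rewrite RB_ge0 (le_trans RB_leR0).
set RB := fine (bayes_risk w L P); set R0 := fine (no_data_risk w L).
have RB_E : (RB)%:E = bayes_risk w L P by rewrite fineK.
have R0_E : (R0)%:E = no_data_risk w L by rewrite fineK.
apply: le_ereal_inf_tmp => _ [Q _ <-]; apply: phi_f_le => //.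
- by rewrite -!lee_fin RB_E R0_E RB_ge0.
- by rewrite -lte_fin -lee_fin R0_E R0_gt0.
move=> u v /andP[u0 u1] v1; have v0 := lt_le_trans ltr01 v1.
have uv := le_trans u1 v1.
have slope_uv := support_slope_le f_convex u0 uv.
have intercept_uv := support_intercept_ge f_convex u0 uv.
have := support_line_minorant f_convex v0; have := support_line_minorant f_convex u0.
move: slope_uv intercept_uv.
move: (support_slope f u) (support_slope f v) => b1 b0 b10.
move: (support_intercept f u) (support_intercept f v) => a1 a0 a01 m1 m0.
have rule_bound (delta : X -> A) : measurable_fun setT delta ->
  (a0 + b0 + (a1 - a0) * R0 +
    (b1 - b0) * fine (\int[w]_t \int[P t]_x (L t (delta x))%:E))%:E
  <= \int[w]_t fdiv f (P t) Q.
  move=> mdelta; have mL := measurable_loss_rule L_measurable mdelta.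
  have := two_point_bound w P_measurable f_convex f1 Q mL
    (fun z => L_itv z.1 (delta z.2)) m1 m0.
  apply: le_trans; rewrite lee_fin lerD2r lerD2l ler_wpM2l ?subr_ge0//.
  have R0_leQ := no_data_risk_le_independent w L_measurable L_itv Q mdelta.
  have Q_fin := fin_num_unit_interval (rule_risk_itv w L_itv (fun=> Q) delta).
  by rewrite -lee_fin (fineK R0_fin) (fineK Q_fin).
have mpoint : measurable_fun setT (cst point : X -> A) by [].
(* The left-hand side is affine and nonincreasing in the risk of the rule, so
   the bound passes to the infimum; if the coefficient b1 - b0 vanishes, any
   rule does. *)
move: rule_bound; case: (\int[w]_t fdiv f (P t) Q) => [j| |] rule_bound.
- have [slope0|slope_neq] := eqVneq b1 b0.
    by have := rule_bound _ mpoint; rewrite slope0 subrr !mul0r !lee_fin; lra.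
  have k0 : (0 < b0 - b1)%R by rewrite subr_gt0 lt_neqAle slope_neq.
  pose c := (a0 + b0 + (a1 - a0) * R0 - j)%R.
  have : (c / (b0 - b1))%:E <= bayes_risk w L P.
    apply: le_ereal_inf_tmp => _ [delta mdelta <-].
    have rfin := fin_num_unit_interval (rule_risk_itv w L_itv P delta).
    rewrite -(fineK rfin) lee_fin ler_pdivrMr//.
    by have := rule_bound _ mdelta; rewrite lee_fin /c; lra.
  by rewrite -RB_E lee_fin ler_pdivrMr// lee_fin /c; lra.
- exact: leey.
- by have := rule_bound _ mpoint.
Qed.
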